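(* For every $\varepsilon > 0$ there is a modulus $m \le (1/\varepsilon)^{2/\varepsilon}$ such that every symmetric Boolean function on $n$ bits can be computed by a depth-$3$ $\text{MOD}_m$ circuit of size $\exp(O(n^{\varepsilon}))$. In fact, the circuits can be taken to be of the form $\text{MOD}_{p_1} \circ \text{MOD}_{p_2 \cdots p_r} \circ \text{MOD}_{p_1}$, where $p_1,\ldots,p_r$ are distinct primes.
   Context: A Boolean function $f:\{0,1\}^n\to\{0,1\}$ is symmetric if $f(\mathbf{x})$ depends only on the number of ones $|\mathbf{x}|_1$ in $\mathbf{x}$. A $\text{MOD}_m$ gate has unbounded fan-in and outputs $1$ iff the sum of its Boolean inputs (counted with multiplicity of wires) is divisible by $m$. A $\text{MOD}_m$ circuit is a constant-depth circuit all of whose gates are $\text{MOD}_{m'}$ gates for divisors $m'$ of $m$ (equivalently, up to wire multiplicities, $\text{MOD}_m$ gates), taking the input variables (and constants) as inputs. The notation $G_1 \circ G_2 \circ G_3$ denotes a depth-3 circuit whose output gate has type $G_1$, whose middle layer consists of gates of type $G_2$, and whose bottom layer (adjacent to the inputs) consists of gates of type $G_3$. Size is the number of gates; the $O(\cdot)$ is as $n\to\infty$ with $\varepsilon$ fixed.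
   Formalization: The bound m ≤ (1/ε)^{2/ε}, false for large ε (for ε ≥ 1 it forces m ≤ 1), is replaced by m ≤ max(c, (1/ε)^{2/ε}) with c = 6 for ε > 1/2 and c = 30 for ε ≤ 1/2; this changes the bound only for ε above about 0.588 and for about 0.462 < ε ≤ 1/2. *)

(* Defs.v *)
From mathcomp Require Import all_boot all_order all_algebra.
From mathcomp Require Import reals sequences exp.

Set Implicit Arguments.
Unset Strict Implicit.
Unset Printing Implicit Defensive.

Definition symmetric_bf (n : nat) (f : n.-tuple bool -> bool) : Prop :=
  forall x y : n.-tuple bool, count id x = count id y -> f x = f y.

(* A circuit is the list of its gates in topological order: [Gate k] is the
   output of the k-th gate of the list, and the last gate is the output gate.
   Wires may be repeated, so multiplicities are part of the wire list. *)
Variant node (n : nat) : Type :=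
  | Const of bool
  | Input of 'I_n
  | Gate of nat.

Arguments Const {n} _.
Arguments Input {n} _.
Arguments Gate {n} _.

Record gate (n : nat) : Type := MkGate {
  gmod : nat;
  gwires : seq (node n)
}.

Definition circuit (n : nat) : Type := seq (gate n).

Section Circuits.
Variable n : nat.
Implicit Types (C : circuit n) (g : gate n) (w : node n) (x : n.-tuple bool).

Definition node_val x (v : seq bool) w : bool :=
  match w with
  | Const b => b
  | Input i => tnth x i
  | Gate k => nth false v k
  end.

Definition gate_val x (v : seq bool) g : bool :=
  gmod g %| \sum_(w <- gwires g) node_val x v w.

Definition gate_vals x C : seq bool :=
  foldl (fun v g => rcons v (gate_val x v g)) [::] C.

Definition circuit_val C x : bool := last false (gate_vals x C).

Definition computes C (f : n.-tuple bool -> bool) : Prop :=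
  forall x, circuit_val C x = f x.

Definition node_depth (d : seq nat) w : nat :=
  if w is Gate k then nth 0 d k else 0.

Definition gate_depths C : seq nat :=
  foldl (fun d g => rcons d (\max_(w <- gwires g) node_depth d w).+1) [::] C.

Definition circuit_depth C : nat := \max_(d <- gate_depths C) d.

Definition well_formed C : Prop :=
  0 < size C /\
  forall C1 g C2, C = C1 ++ g :: C2 ->
    all (fun w => if w is Gate k then k < size C1 else true) (gwires g).

Definition MOD_circuit (m : nat) C : Prop :=
  well_formed C /\ all (fun g => gmod g %| m) C.

Definition reads_inputs w : bool := if w is Gate _ then false else true.

Definition reads_gates (a b : nat) w : bool :=
  match w with
  | Const _ => true
  | Input _ => false
  | Gate k => a <= k < b
  end.

(* MOD_a o MOD_b o MOD_c, written from the output gate down to the inputs;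
   no wire skips a layer. *)
Definition MOD3_form (a b c : nat) C : Prop :=
  exists (bot mid : seq (gate n)) (out : gate n),
    [/\ C = bot ++ mid ++ [:: out],
        all (fun g => (gmod g == c) && all reads_inputs (gwires g)) bot,
        all (fun g => (gmod g == b) &&
               all (reads_gates 0 (size bot)) (gwires g)) mid
      & (gmod out == a) &&
        all (reads_gates (size bot) (size bot + size mid)) (gwires out)].

End Circuits.

(* The value (1/eps)^(2/eps) alone is too small when eps is not small: below 6
   it admits no modulus, or only prime powers, for which a constant-depth MOD_m
   circuit is a polynomial of bounded degree and cannot compute, say, the AND
   of many bits. The floors 6 = 2 * 3 and 30 = 2 * 3 * 5 are inactive for
   eps <= 5/11, and also for 1/2 < eps <= 4/7. *)
Definition modulus_bound (R : realType) (eps : R) : R :=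
  (Num.max (if eps <= 2^-1 then 30 else 6) (eps^-1 `^ (2 / eps)))%R.

(* Main.v *)
From HB Require Import structures.
Require Import Defs.
From mathcomp Require Import all_boot all_order all_algebra.
From mathcomp Require Import reals sequences exp.
From mathcomp Require Import zify ring lra.

(* Take p_1 = 2 and odd primes p_2, ..., p_r with 1/r < eps, put q = p_2 ... p_r
   and choose exponents with t <= p_i ^ e_i <= p_i * t, where t is about n^(1/r),
   so that the product of the p_i ^ e_i exceeds n: the weight N = |x| equals k iff
   N = k mod p_i ^ e_i for every i.
   Being periodic, [N = k mod p^e] is modulo p a combination of the binomials
   'C(N, j) with j < p^e, that is, a symmetric polynomial of degree d = O(t) in x.
   - The bottom layer consists of all parities of at most d inputs. As 2 is
     invertible modulo q, every monomial of degree <= d is a combination modulo q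
     of these parities, so one MOD_q gate tests N = k mod p_i ^ e_i for all i >= 2.
   - The test modulo 2 ^ e_1 is a polynomial of degree <= d over F_2, and the
     product of a MOD_q gate with a monomial is a sum modulo 2 of (2q)^d MOD_q
     gates over the same bottom layer.
   - The output gate adds up, modulo 2, the tests for those k where f is 1.
   The size is n^O(d) = exp(O(n^(1/r) log n)) = exp(O(n^eps)). Chebyshev's lower
   bound on the number of primes keeps the modulus below (1/eps)^(2/eps). *)

Set Implicit Arguments.
Unset Strict Implicit.
Unset Printing Implicit Defensive.

(** * Primes of small product *)

Lemma modn_eqM k a a' b b' :
  a = a' %[mod k] -> b = b' %[mod k] -> a * b = a' * b' %[mod k].
Proof. by move=> e1 e2; rewrite -modnMm e1 e2 modnMm. Qed.

Lemma modn_eqD k a a' b b' :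
  a = a' %[mod k] -> b = b' %[mod k] -> a + b = a' + b' %[mod k].
Proof. by move=> e1 e2; rewrite -modnDm e1 e2 modnDm. Qed.

Lemma modn_eq_sum (I : Type) (r : seq I) (P : pred I) k (F G : I -> nat) :
  (forall i, P i -> F i = G i %[mod k]) ->
  \sum_(i <- r | P i) F i = \sum_(i <- r | P i) G i %[mod k].
Proof.
move=> FG; elim/big_ind2: _ => // a a' b b'; exact: modn_eqD.
Qed.

(** Induction through the ratio of consecutive central coefficients, the recurrence [E]: the
    left-hand side grows by the factor 4, the right-hand side by at least 4. *)
Lemma central_bin_ge k : 0 < k -> 4 ^ k <= k.*2 * 'C(k.*2, k).
Proof.
case: k => // k _; elim: k => [//|k IH].
have E : k.+2 * 'C(k.+2.*2, k.+2) = 2 * (k.*2.+3 * 'C(k.+1.*2, k.+1)).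
  have e1 : k.+2 * 'C(k.+2.*2, k.+2) = k.+2.*2 * 'C(k.+1.*2.+1, k.+1).
    by rewrite doubleS -mul_bin_diag.
  have e2 : k.+2 * 'C(k.+1.*2.+1, k.+1) = k.+1.*2.+1 * 'C(k.+1.*2, k.+1).
    rewrite mul_bin_down; congr (_ * _); lia.
  nia.
rewrite expnS; nia.
Qed.

(* Legendre's formula: each power p^i <= 2k contributes at most 1 to the valuation. *)
Lemma logn_central_bin p k : prime p -> 0 < k -> p ^ logn p 'C(k.*2, k) <= k.*2.
Proof.
move=> pp k0; have p1 := prime_gt1 pp; have k20 : 0 < k.*2 by rewrite double_gt0.
suff le : logn p 'C(k.*2, k) <= trunc_log p k.*2.
  by apply: leq_trans (trunc_logP p1 k20); rewrite leq_exp2l.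
have fact_log m : m <= k.*2 -> logn p m`! = \sum_(1 <= i < k.*2.+1) m %/ p ^ i.
  move=> mk; rewrite logn_fact // [RHS](big_cat_nat _ _ (n := m.+1)) //=.
  rewrite [X in _ + X]big_nat_cond [X in _ + X]big1 ?addn0 // => i.
  rewrite andbT => /andP[mi _]; rewrite divn_small //.
  by apply: leq_trans (ltn_expl _ p1); exact: ltnW.
have E : logn p 'C(k.*2, k) + 2 * logn p k`! = logn p (k.*2)`!.
  have kk : k <= k.*2 by rewrite -addnn leq_addr.
  rewrite -(bin_fact kk) !lognM ?muln_gt0 ?fact_gt0 ?bin_gt0 //.
  by rewrite -addnn addnK; lia.
have : logn p (k.*2)`! <= trunc_log p k.*2 + 2 * logn p k`!; last lia.
have kk : k <= k.*2 by rewrite -addnn leq_addr.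
rewrite !fact_log // big_distrr /=.
have -> : trunc_log p k.*2 = \sum_(1 <= i < k.*2.+1) (p ^ i <= k.*2).
  have tl : trunc_log p k.*2 <= k.*2.
    by apply: leq_trans (trunc_logP p1 k20); apply/ltnW/ltn_expl.
  rewrite (big_cat_nat _ _ (n := (trunc_log p k.*2).+1)) //=.
  rewrite (eq_big_nat _ _ (F2 := fun=> 1)) => [|i /andP[_ it]]; last first.
    by rewrite (leq_trans _ (trunc_logP p1 k20)) // leq_exp2l.
  rewrite sum_nat_const_nat subn1 /= muln1.
  rewrite big_nat_cond big1 ?addn0 // => i /andP[/andP[ti _] _].
  by rewrite leqNgt (leq_trans (trunc_log_ltn _ p1)) // leq_exp2l.
rewrite -big_split /=; apply: leq_sum => i _.
have pi0 : 0 < p ^ i by rewrite expn_gt0 prime_gt0.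
have [le|gt] := leqP (p ^ i) k.*2; last by rewrite divn_small.
rewrite -ltnS; rewrite ltn_divLR //.
have := ltn_ceil k pi0; nia.
Qed.

(** Every prime power in the factorization is at most [k.*2], so a large coefficient forces many
    distinct primes. *)
Lemma bin_le_primes k : 0 < k -> 'C(k.*2, k) <= k.*2 ^ size (primes 'C(k.*2, k)).
Proof.
move=> k0; have B0 : 0 < 'C(k.*2, k) by rewrite bin_gt0 -addnn leq_addr.
rewrite {1}(prod_prime_decomp B0) prime_decompE big_map /=.
rewrite -sum1_size expn_sum big_seq [leqRHS]big_seq; apply: leq_prod => p.
by rewrite mem_primes expn1 => /andP[pp _]; apply: logn_central_bin.
Qed.

Lemma primes_bin_le p k : p \in primes 'C(k.*2, k) -> 0 < k -> prime p /\ p <= k.*2.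
Proof.
rewrite mem_primes => /and3P[pp _ pB] k0; split => //.
apply: leq_trans (logn_central_bin pp k0).
have B0 : 0 < 'C(k.*2, k) by rewrite bin_gt0 -addnn leq_addr.
by rewrite -{1}(expn1 p) leq_exp2l ?prime_gt1 // logn_gt0 mem_primes pp B0.
Qed.

(** Chebyshev's argument: with k = [(size l).+1], if every prime factor of [B] lay in [l], then [B]
    would have fewer than k of them, whence 4 ^ (k^2) <= (2 k^2) ^ k, contradicting 2 k^2 < 4 ^
    k. *)
Lemma prime_notin (l : seq nat) :
  exists p, [/\ prime p, p \notin l & p <= 2 * (size l).+1 ^ 2].
Proof.
set k := (size l).+1; have k0 : 0 < k ^ 2 by rewrite expn_gt0.
pose B := 'C((k ^ 2).*2, k ^ 2).
have [/hasP[p pB pl]|/hasPn sub] := boolP (has (fun p => p \notin l) (primes B)).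
  by exists p; have [? ?] := primes_bin_le pB k0; rewrite mul2n.
have sz : size (primes B) <= size l.
  by apply: uniq_leq_size (primes_uniq _) _ => p /sub; rewrite negbK.
have pow : 2 * k ^ 2 < 4 ^ k.
  rewrite /k; elim: (size l) => [//|s IH]; move: IH; rewrite !(expnS 4); lia.
have : (4 ^ k) ^ k <= (2 * k ^ 2) ^ k.
  rewrite -expnM mulnn mul2n; apply: leq_trans (central_bin_ge k0) _.
  rewrite -/B (expnS _ (size l)) leq_mul2l; apply/orP; right.
  apply: leq_trans (bin_le_primes k0) _.
  by rewrite leq_pexp2l // double_gt0.
by rewrite leq_exp2r // leqNgt pow.
Qed.

(** Induction from 3, 5, 7, where 210 <= 3 ^ 6. A further prime costs a factor of at most 2 (s+2)^2
    <= 4 (s+1)^2, while the bound grows by at least 4 (s+1)^2. *)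
Lemma odd_primes_small_product s : 3 <= s ->
  exists ps : seq nat, [/\ all prime (2 :: ps), uniq (2 :: ps), size ps = s
    & 2 * \prod_(p <- ps) p <= s ^ (2 * s)].
Proof.
elim: s => // s IH; rewrite leq_eqVlt => /orP[/eqP<-|lt].
  by exists [:: 3; 5; 7]; split=> //; rewrite !big_cons big_nil.
have [ps [pr un sz le]] := IH lt.
have [p [pp pn ple]] := prime_notin (2 :: ps).
exists (p :: ps); split.
- by move: pr => /= ->; rewrite pp.
- move: pn un; rewrite /= !inE => /norP[p2 pps] /andP[n2 ->].
  by rewrite (negbTE pps) (negbTE n2) eq_sym (negbTE p2).
- by rewrite /= sz.
rewrite big_cons; move: ple; rewrite /= sz => ple.
(* The first two terms of the expansion of (s+1)^s are both equal to s^s. *)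
have bern : 2 * s ^ s <= s.+1 ^ s.
  have s0 : 0 < s by lia.
  rewrite -(addn1 s) expnDn (bigD1 ord0) //= (bigD1 (lift ord0 (Ordinal s0))) //=.
  rewrite !exp1n !muln1 bin0 subn0 mul1n bin1.
  by rewrite subn1 /bump /= -expnS prednK //; lia.
have -> : s.+1 ^ (2 * s.+1) = (s.+1 ^ s) ^ 2 * s.+1 ^ 2.
  by rewrite -expnM -expnD; congr (_ ^ _); lia.
have : s ^ (2 * s) = (s ^ s) ^ 2 by rewrite -expnM mulnC.
have b2 : (2 * s ^ s) ^ 2 <= (s.+1 ^ s) ^ 2 by rewrite leq_exp2r.
move=> E; rewrite E in le.
have : p * (2 * \prod_(p <- ps) p) <= (2 * s.+2 ^ 2) * (s ^ s) ^ 2 by apply: leq_mul.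
have : (2 * s ^ s) ^ 2 * s.+1 ^ 2 <= (s.+1 ^ s) ^ 2 * s.+1 ^ 2 by rewrite leq_mul2r b2 orbT.
have : 2 * s.+2 ^ 2 <= 4 * s.+1 ^ 2 by nia.
rewrite expnMn; set a := (s ^ s) ^ 2; set b := (_ ^ s) ^ 2 => h1 h2 h3.
have : 2 * s.+2 ^ 2 * a <= 4 * s.+1 ^ 2 * a by rewrite leq_mul2r h1 orbT.
lia.
Qed.

(** * Periodic functions as combinations of binomials *)

(** In i C(p^e, i) = p^e C(p^e - 1, i - 1), if p did not divide the coefficient, p^e would have to
    divide i, which is too small. *)
Lemma prime_dvd_bin_exp p e i : prime p -> 0 < i < p ^ e -> p %| 'C(p ^ e, i).
Proof.
move=> pp /andP[i0 ie]; case: i i0 ie => // i _ ie.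
have E := mul_bin_diag (p ^ e) i.
have B0 : 0 < 'C(p ^ e, i.+1) by rewrite bin_gt0 ltnW.
have : p ^ e %| i.+1 * 'C(p ^ e, i.+1) by rewrite -E dvdn_mulr.
have [//|] := boolP (p %| _); rewrite -prime_coprime // => cop.
rewrite Gauss_dvdl ?coprimeXl // => /dvdn_leq; lia.
Qed.

(** In Vandermonde's sum only the term that draws nothing from the extra [p ^ e] elements survives
    modulo [p]. *)
Lemma bin_periodic p e N j : prime p -> j < p ^ e ->
  'C(N + p ^ e, j) = 'C(N, j) %[mod p].
Proof.
move=> pp je; rewrite addnC -binomial.Vandermonde big_ord_recl /= bin0 mul1n subn0.
rewrite -[in RHS](addn0 'C(N, j)); apply: modn_eqD => //.
apply/eqP; rewrite mod0n -/(dvdn _ _); apply: dvdn_sum => i _.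
by rewrite dvdn_mulr // prime_dvd_bin_exp // (leq_ltn_trans _ je) //=; case: i.
Qed.

(** At N = |x|, ['C(N, j)] is the j-th elementary symmetric polynomial in the bits, so these are
    symmetric polynomials of degree at most [d]. Natural coefficients suffice, since values matter
    only modulo a prime or [q]. *)
Definition binpoly (d : nat) (h : nat -> nat) : Prop :=
  exists c : nat -> nat, forall N, h N = \sum_(j < d.+1) c j * 'C(N, j).

Lemma binpolyD d g h : binpoly d g -> binpoly d h -> binpoly d (fun N => g N + h N).
Proof.
move=> [c cE] [c' cE']; exists (fun j => c j + c' j) => N.
by rewrite cE cE' -big_split; apply: eq_bigr => j _; rewrite mulnDl.
Qed.

Lemma binpolyZ d a h : binpoly d h -> binpoly d (fun N => a * h N).
Proof.
move=> [c cE]; exists (fun j => a * c j) => N.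
by rewrite cE big_distrr; apply: eq_bigr => j _; rewrite /= mulnA.
Qed.

(** The system is triangular: ['C(N, M)] vanishes for N < M and is 1 at N = M, so each new
    coefficient corrects one value and spoils none. *)
Lemma newton_interpolation p (g : nat -> nat) M : 0 < p ->
  exists c : nat -> nat, forall N, N < M ->
    \sum_(j < M) c j * 'C(N, j) = g N %[mod p].
Proof.
move=> p0; elim: M => [|M [c cE]]; first by exists id.
pose s := \sum_(j < M) c j * 'C(M, j).
(* This stands for g(M) - s modulo [p], without subtraction. *)
pose a := g M + (p - 1) * s.
exists (fun j => if j < M then c j else a) => N; rewrite ltnS => NM.
rewrite big_ord_recr /= ltnn.
rewrite (eq_bigr (fun j : 'I_M => c j * 'C(N, j))) => [|j _]; last by rewrite ltn_ord.
move: NM; rewrite leq_eqVlt => /orP[/eqP->|NM]; last first.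
  by rewrite bin_small // muln0 addn0 cE.
rewrite binn muln1 -/s /a.
have -> : s + (g M + (p - 1) * s) = p * s + g M by nia.
by rewrite mulnC modnMDl.
Qed.

(** Interpolation on one period suffices, because the binomials involved have the same period modulo
    [p]. *)
Lemma periodic_binpoly p e d (g : nat -> nat) : prime p -> p ^ e <= d.+1 ->
  (forall N, g (N + p ^ e) = g N) ->
  exists2 h, binpoly d h & forall N, h N = g N %[mod p].
Proof.
move=> pp ed per; have p0 := prime_gt0 pp.
have [c cE] := newton_interpolation g (p ^ e) p0.
pose c' j := if j < p ^ e then c j else 0.
exists (fun N => \sum_(j < d.+1) c' j * 'C(N, j)); first by exists c'.
move=> N; rewrite -(big_mkord predT (fun j => c' j * 'C(N, j))).
rewrite (big_cat_nat _ _ (n := p ^ e)) //= [X in _ + X]big_nat_cond.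
rewrite [X in _ + X]big1 ?addn0 => [|i /andP[/andP[ei _] _]]; last first.
  by rewrite /c' ltnNge ei.
rewrite big_mkord (eq_bigr (fun j : 'I_(p ^ e) => c j * 'C(N, j))); last first.
  by move=> j _; rewrite /c' ltn_ord.
rewrite (divn_eq N (p ^ e)); elim: (N %/ p ^ e) => [|k IH].
  by rewrite mul0n add0n cE // ltn_mod expn_gt0 p0.
rewrite mulSn [p ^ e + _]addnC -addnA [p ^ e + _]addnC addnA per -IH.
by apply: modn_eq_sum => j _; apply: modn_eqM => //; apply: bin_periodic.
Qed.

Lemma residue_binpoly p e d k : prime p -> p ^ e <= d.+1 ->
  exists2 h, binpoly d h & forall N, h N = (N == k %[mod p ^ e]) %[mod p].
Proof.
move=> pp ed; apply: (periodic_binpoly (g := fun N => N == k %[mod p ^ e]) pp ed).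
by move=> N; rewrite modnDr.
Qed.

(** A MOD gate accepts on the residue 0, so the indicator of non-congruence is the one to be
    represented. *)
Lemma nonresidue_binpoly p e d k : prime p -> p ^ e <= d.+1 ->
  exists2 h, binpoly d h & forall N, (p %| h N) = (N == k %[mod p ^ e]).
Proof.
move=> pp ed.
have [//|h hb hE] := periodic_binpoly (g := fun N => N != k %[mod p ^ e]) pp ed.
  by move=> N; rewrite modnDr.
exists h => // N; rewrite /dvdn hE; case: (N == k %[mod _]); rewrite /= ?mod0n //.
by rewrite modn_small // prime_gt1.
Qed.

Lemma coprime_prod_primes (ps : seq nat) (e : nat -> nat) p a :
  prime p -> all prime ps -> p \notin ps -> coprime (p ^ a) (\prod_(p <- ps) p ^ e p).
Proof.
move=> pp pr pn; rewrite big_seq; elim/big_rec: _ => [|p' m p'ps cop].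
  exact: coprimen1.
rewrite coprimeMr cop andbT; apply: coprimeXl; apply: coprimeXr.
rewrite prime_coprime // dvdn_prime2 ?(allP pr _ p'ps) //.
by apply: contraNneq pn => ->.
Qed.

Lemma residues_binpoly (ps : seq nat) (e : nat -> nat) d k :
  all prime ps -> uniq ps -> (forall p, p \in ps -> p ^ e p <= d.+1) ->
  exists2 h, binpoly d h & forall N,
    (\prod_(p <- ps) p %| h N) = all (fun p => N == k %[mod p ^ e p]) ps.
Proof.
elim: ps => [|p ps IH] /= pr un ed.
  exists (fun=> 0); last by move=> N; rewrite big_nil.
  by exists (fun=> 0) => N; rewrite big1.
case/andP: pr => pp pr; case/andP: un => pn un.
have [|h hb hE] := IH pr un; first by move=> p' h'; apply: ed; rewrite inE h' orbT.
have [|g gb gE] := nonresidue_binpoly k pp (e := e p) (d := d).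
  by apply: ed; rewrite mem_head.
set Q := \prod_(p <- ps) p in hE *.
have cop : coprime p Q := coprime_prod_primes (fun=> 1) 1 pp pr pn.
(* Modulo [p] only [Q * g N] remains and modulo [Q] only [p * h N], each with an invertible
   factor. *)
exists (fun N => p * h N + Q * g N); first by apply: binpolyD; apply: binpolyZ.
move=> N; rewrite big_cons -/Q Gauss_dvd //.
rewrite (dvdn_addr _ (dvdn_mulr _ (dvdnn p))) (dvdn_addl _ (dvdn_mulr _ (dvdnn Q))).
by rewrite (Gauss_dvdr _ cop) Gauss_dvdr ?hE ?gE 1?andbC // coprime_sym.
Qed.

Lemma chinese_remainder_seq (ps : seq nat) (e : nat -> nat) N k :
  all prime ps -> uniq ps ->
  all (fun p => N == k %[mod p ^ e p]) ps = (N == k %[mod \prod_(p <- ps) p ^ e p]).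
Proof.
elim: ps => [|p ps IH] /=; first by rewrite big_nil !modn1 eqxx.
move=> /andP[pp pr] /andP[pn un]; rewrite big_cons chinese_remainder ?IH //.
exact: coprime_prod_primes.
Qed.

(** * Layered circuits *)

(** The encoding supplies decidable equality, by which a parity gate is located in the bottom layer
    with [index]. *)
Definition node_code {n} (w : node n) : bool + 'I_n + nat :=
  match w with
  | Const b => inl (inl b)
  | Input i => inl (inr i)
  | Gate k => inr k
  end.

Definition node_decode {n} (c : bool + 'I_n + nat) : node n :=
  match c with
  | inl (inl b) => Const b
  | inl (inr i) => Input i
  | inr k => Gate k
  end.

Lemma node_codeK n : cancel (@node_code n) node_decode.
Proof. by case. Qed.

HB.instance Definition _ n := Equality.copy (node n) (can_type (@node_codeK n)).

Lemma gate_codeK n :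
  cancel (fun g : gate n => (gmod g, gwires g)) (fun c => MkGate c.1 c.2).
Proof. by case. Qed.

HB.instance Definition _ n := Equality.copy (gate n) (can_type (@gate_codeK n)).

Definition reads_below {n} (b : nat) (w : node n) : bool :=
  if w is Gate k then k < b else true.

Lemma reads_inputs_below n b (w : node n) : reads_inputs w -> reads_below b w.
Proof. by case: w. Qed.

Lemma reads_gates_below n a b (w : node n) :
  reads_gates a b w -> reads_below b w.
Proof. by case: w => //= k /andP[]. Qed.

Lemma reads_below_leq n b c (w : node n) :
  b <= c -> reads_below b w -> reads_below c w.
Proof. by case: w => //= k bc kb; apply: leq_trans kb bc. Qed.

Definition layer_over {n} (b : nat) (L : seq (gate n)) : bool :=
  all (fun g => all (reads_below b) (gwires g)) L.

(** Gates of a layer read only what precedes the layer, so evaluating them in sequence is a [map].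
    The evaluator [ev] is abstract in order to cover both values and depths. *)
Lemma foldl_layer n (A : Type) (ev : seq A -> gate n -> A) (v : seq A) L :
  (forall u g, all (reads_below (size v)) (gwires g) ->
     ev (v ++ u) g = ev v g) ->
  layer_over (size v) L ->
  foldl (fun v g => rcons v (ev v g)) v L = v ++ map (ev v) L.
Proof.
move=> evE; elim/last_ind: L => [|L g IH]; first by rewrite cats0.
rewrite /layer_over all_rcons => /andP[gv /IH E].
by rewrite foldl_rcons E map_rcons evE // rcons_cat.
Qed.

Lemma gate_val_cat n (x : n.-tuple bool) v u g :
  all (reads_below (size v)) (gwires g) ->
  gate_val x (v ++ u) g = gate_val x v g.
Proof.
move=> /allP gv; rewrite /gate_val; congr (_ %| _).
rewrite !big_seq; apply: eq_bigr => w /gv.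
by case: w => //= k kv; rewrite nth_cat kv.
Qed.

Lemma size_gate_vals n (x : n.-tuple bool) C : size (gate_vals x C) = size C.
Proof.
by elim/last_ind: C => //= s g IH; rewrite /gate_vals foldl_rcons !size_rcons IH.
Qed.

Lemma gate_vals_cat n (x : n.-tuple bool) C L :
  layer_over (size C) L ->
  gate_vals x (C ++ L) = gate_vals x C ++ map (gate_val x (gate_vals x C)) L.
Proof.
rewrite -(size_gate_vals x) => hL; rewrite {1}/gate_vals foldl_cat; apply: foldl_layer => // u g.
exact: gate_val_cat.
Qed.

Lemma gate_depths_layer n (C L : seq (gate n)) D :
  layer_over (size C) L -> all (leq^~ D) (gate_depths C) ->
  all (leq^~ D.+1) (gate_depths (C ++ L)).
Proof.
have sz C' : size (@gate_depths n C') = size C'.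
  by elim/last_ind: C' => //= s g IH; rewrite /gate_depths foldl_rcons !size_rcons IH.
rewrite -sz => hL dC; rewrite /gate_depths foldl_cat foldl_layer //; last first.
  move=> u g /allP gv; congr _.+1; rewrite !big_seq; apply: eq_bigr => w /gv.
  by case: w => //= k kv; rewrite nth_cat kv.
rewrite all_cat; apply/andP; split.
  by apply: sub_all dC => i /leq_trans; apply.
rewrite all_map; apply/allP => g _ /=; rewrite ltnS.
apply/bigmax_leqP_seq => -[] //= k _ _.
have [kd|kd] := ltnP k (size (gate_depths C)).
  by move/all_nthP: dC => /(_ 0 _ kd).
by rewrite nth_default.
Qed.

(** This is [well_formed] without nonemptiness, so that an induction over layers can start from the
    empty circuit. *)
Definition wired_downwards {n} (C : circuit n) : Prop :=
  forall C1 g C2, C = C1 ++ g :: C2 -> all (reads_below (size C1)) (gwires g).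

Lemma wired_downwards_cat n (C L : circuit n) :
  wired_downwards C -> layer_over (size C) L -> wired_downwards (C ++ L).
Proof.
move=> wC hL C1 g C2 E.
have [lt|ge] := ltnP (size C1) (size C).
  apply: (wC C1 g (drop (size C1).+1 C)).
  have := congr1 (take (size C1)) E; have := congr1 (fun s => nth g s (size C1)) E.
  rewrite /= nth_cat lt nth_cat ltnn subnn /= => gE.
  rewrite takel_cat 1?ltnW // take_cat ltnn subnn take0 cats0 => tE.
  by rewrite -[LHS](cat_take_drop (size C1)) tE (drop_nth g lt) gE.
have gL : g = nth g L (size C1 - size C).
  have := congr1 (fun s => nth g s (size C1)) E.
  by rewrite /= nth_cat ltnNge ge /= nth_cat ltnn subnn.
have lL : size C1 - size C < size L.
  have := congr1 size E; rewrite !size_cat /=; lia.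
move/all_nthP: hL => /(_ g _ lL); rewrite -gL.
by apply: sub_all => w; apply: reads_below_leq.
Qed.

Lemma wired_downwards_nil n : @wired_downwards n [::].
Proof. by case. Qed.

Section ThreeLayers.
Variables (n a b c : nat) (bot mid : seq (gate n)) (out : gate n).
Hypothesis botP :
  all (fun g => (gmod g == c) && all (@reads_inputs n) (gwires g)) bot.
Hypothesis midP : all (fun g => (gmod g == b) &&
  all (reads_gates 0 (size bot)) (gwires g)) mid.
Hypothesis outP : (gmod out == a) &&
  all (reads_gates (size bot) (size bot + size mid)) (gwires out).
Let C := bot ++ mid ++ [:: out].

Let lbot : layer_over 0 bot.
Proof.
apply: sub_all botP => g /andP[_]; apply: sub_all => w; exact: reads_inputs_below.
Qed.

Let lmid : layer_over (size bot) mid.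
Proof.
apply: sub_all midP => g /andP[_]; apply: sub_all => w; exact: reads_gates_below.
Qed.

Let lout : layer_over (size (bot ++ mid)) [:: out].
Proof.
rewrite /layer_over /= andbT size_cat; case/andP: outP => _.
apply: sub_all => w; exact: reads_gates_below.
Qed.

Lemma three_layers_wf : well_formed C.
Proof.
split; first by rewrite /C catA size_cat addn1.
rewrite /C catA; do 2 apply: wired_downwards_cat => //.
apply: (@wired_downwards_cat n [::]) => //; exact: wired_downwards_nil.
Qed.

Lemma three_layers_depth : circuit_depth C <= 3.
Proof.
apply/bigmax_leqP_seq => i iC _.
suff /allP /(_ _ iC) : all (leq^~ 3) (gate_depths C) by [].
rewrite /C catA; do 2 apply: gate_depths_layer => //.
exact: (@gate_depths_layer n [::]).
Qed.

Lemma three_layers_MOD m : a %| m -> b %| m -> c %| m -> MOD_circuit m C.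
Proof.
move=> am bm cm; split; first exact: three_layers_wf.
rewrite !all_cat /= andbT; apply/and3P; split.
- by apply: sub_all botP => g /andP[/eqP->].
- by apply: sub_all midP => g /andP[/eqP->].
- by case/andP: outP => /eqP->.
Qed.

Lemma three_layers_vals x : gate_vals x (bot ++ mid) =
  gate_vals x bot ++ map (gate_val x (gate_vals x bot)) mid.
Proof. exact: gate_vals_cat. Qed.

Lemma three_layers_val x :
  circuit_val C x = gate_val x (gate_vals x (bot ++ mid)) out.
Proof. by rewrite /circuit_val /C catA gate_vals_cat // last_cat. Qed.

End ThreeLayers.

(** * Sums of gates over the parity layer *)

(** The monomials equal to 1 at [x] are those of the j-subsets of its support. *)
Lemma bin_count_monomials n (x : n.-tuple bool) j :
  'C(count id x, j) =
  \sum_(A : {set 'I_n} | #|A| == j) \prod_(i <- enum A) tnth x i.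
Proof.
have -> : count id x = #|[set i | tnth x i]|.
  rewrite -{1}(map_tnth_enum x) count_map cardsE cardE -size_filter.
  by rewrite {1}/enum_mem -filter_predI; congr size; apply: eq_filter => i; rewrite /= andbT.
rewrite -cards_draws -sum1dep_card.
rewrite [RHS](bigID (fun A : {set 'I_n} => A \subset [set i | tnth x i])) /=.
rewrite [X in _ + X]big1 ?addn0 => [|A /andP[_ /subsetPn[i iA]]]; last first.
  by rewrite inE => /negbTE xi; rewrite (bigD1_seq i) ?mem_enum ?enum_uniq //= xi.
apply: eq_big => [A|A]; first by rewrite andbC.
move=> /andP[/subsetP sA _]; rewrite big1_seq // => i /andP[_].
by rewrite mem_enum => /sA; rewrite inE => ->.
Qed.

(* [None] pads the wire list with zeros, so that tuples of length d encode all
   parities of at most d inputs. *)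
Definition parity_gate {n} (T : seq (option 'I_n)) (b : bool) : gate n :=
  MkGate 2 (Const b :: [seq if o is Some i then Input i else Const false | o <- T]).

Definition parity_layer (n d : nat) : seq (gate n) :=
  [seq parity_gate (tval p.1) p.2 | p : d.-tuple (option 'I_n) * bool].

Lemma size_parity_layer n d : size (parity_layer n d) = n.+1 ^ d * 2.
Proof. by rewrite size_map -cardE card_prod card_tuple card_option card_ord card_bool. Qed.

Lemma parity_layer_inputs n d :
  all (fun g => (gmod g == 2) && all (@reads_inputs n) (gwires g)) (parity_layer n d).
Proof.
by apply/allP => _ /mapP[[T b] _ ->] /=; rewrite all_map; apply/allP => -[].
Qed.

Section Simulation.
Variables (n d q : nat).
Hypotheses (d_gt0 : 0 < d) (q_odd : odd q) (q_gt1 : 1 < q).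
Implicit Types (x : n.-tuple bool) (L F : n.-tuple bool -> nat).
Let bot := parity_layer n d.

Definition feeds (b : nat) : pred (gate n) :=
  fun g => (gmod g == b) && all (reads_gates 0 (size bot)) (gwires g).

(* What the wires from the bottom layer into a MOD_q gate can sum up to. *)
Definition lin L : Prop :=
  exists2 ws : seq (node n), all (reads_gates 0 (size bot)) ws
    & forall x, \sum_(w <- ws) node_val x (gate_vals x bot) w = L x %[mod q].

Lemma lin_ext L L' : (forall x, L x = L' x %[mod q]) -> lin L -> lin L'.
Proof. by move=> E [ws h1 h2]; exists ws => // x; rewrite h2. Qed.

Lemma lin_const c : lin (fun=> c).
Proof.
exists (nseq c (Const true)); first by rewrite all_nseq orbT.
by move=> x; rewrite big_nseq iter_addn_0 mul1n.
Qed.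

Lemma linD L L' : lin L -> lin L' -> lin (fun x => L x + L' x).
Proof.
move=> [ws h1 h2] [ws' h1' h2']; exists (ws ++ ws'); first by rewrite all_cat h1.
by move=> x; rewrite big_cat; apply: modn_eqD.
Qed.

Lemma linZ c L : lin L -> lin (fun x => c * L x).
Proof.
move=> hL; elim: c => [|c IH]; first exact: lin_const.
by apply: lin_ext (linD hL IH) => x; rewrite mulSn.
Qed.

Lemma lin_sum (I : Type) (r : seq I) (P : pred I) (G : I -> n.-tuple bool -> nat) :
  (forall i, P i -> lin (G i)) -> lin (fun x => \sum_(i <- r | P i) G i x).
Proof.
move=> hG; elim: r => [|i r IH].
  by apply: lin_ext (lin_const 0) => x; rewrite big_nil.
case Pi: (P i); last by apply: lin_ext IH => x; rewrite big_cons Pi.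
by apply: lin_ext (linD (hG i Pi) IH) => x; rewrite big_cons Pi.
Qed.

(** As a [MOD_2] gate accepts even sums, [parity x [:: j] false] is 1 - x_j and [parity x [::]
    false] is the constant 1. *)
Definition parity x (T : seq 'I_n) (b : bool) : bool :=
  2 %| b + \sum_(i <- T) tnth x i.

Lemma lin_parity T b : size T <= d -> lin (fun x => parity x T b).
Proof.
move=> sT; pose T' := map Some T ++ nseq (d - size T) None.
have sT' : size T' == d by rewrite size_cat size_map size_nseq subnKC.
pose g := parity_gate (n := n) T' b.
have gbot : g \in bot.
  by apply/mapP; exists (Tuple sT', b); rewrite ?mem_enum.
have ltg : index g bot < size bot by rewrite index_mem.
exists [:: Gate (index g bot)]; first by rewrite /= andbT.
move=> x; rewrite big_seq1 /=.
rewrite -[bot]cat0s gate_vals_cat; last first.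
  apply: sub_all (parity_layer_inputs n d) => h /andP[_].
  by apply: sub_all => w; apply: reads_inputs_below.
rewrite cat0s (nth_map g) // nth_index //; congr ((_ : bool) %% _).
rewrite /gate_val /g /= /T' big_cons /= map_cat big_cat /= -map_comp big_map.
rewrite [X in _ + (_ + X)]big1_seq ?addn0 // => w /andP[_ /mapP[o]].
by rewrite mem_nseq => /andP[_ /eqP->] ->.
Qed.

(* Modulo q, 2 is inverted in 2 G(T, b) x_j = G(T, b) + G(j :: T, ~~ b) - G([:: j], false),
   where G = parity; this removes one factor x_j at a time. *)
Lemma lin_parity_prod S T b : size T + size S <= d ->
  lin (fun x => parity x T b * \prod_(i <- S) tnth x i).
Proof.
elim: S T b => [|j S IH] T b; rewrite /= ?addn0.
  by move=> /(lin_parity b); apply: lin_ext => x; rewrite big_nil muln1.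
move=> sz.
have h1 := IH T b ltac:(lia).
have h2 := IH (j :: T) (~~ b) ltac:(rewrite /=; lia).
have h3 := IH [:: j] false ltac:(rewrite /=; lia).
(* For odd [q], [uphalf q] = (q+1)/2 is the inverse of 2 modulo [q]; [q.-1] plays -1. *)
have := linZ (uphalf q) (linD (linD h1 h2) (linZ q.-1 h3)); apply: lin_ext => x.
rewrite big_cons; set P := \prod_(i <- S) _; set B := parity x T b.
have E : B + parity x (j :: T) (~~ b) = 2 * (B * tnth x j) + parity x [:: j] false.
  rewrite /B /parity !big_cons big_nil !dvdn2 !oddD !oddb.
  by case: (odd (\sum_(i <- T) _)); case: (tnth x j); case: b {h1 h2 B}.
set A' := parity x (j :: T) _ in E *; set A'' := parity x [:: j] _ in E *.
have qE : q.+1 = uphalf q * 2.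
  by rewrite uphalf_half q_odd; have := odd_double_half q; rewrite q_odd; lia.
have -> : uphalf q * (B * P + A' * P + q.-1 * (A'' * P)) =
    (B * tnth x j * P + uphalf q * A'' * P) * q + B * (tnth x j * P).
  have -> : B * P + A' * P = (B + A') * P by rewrite mulnDl.
  rewrite E; have qE' := congr1 (fun a => a * (B * tnth x j * P)) qE.
  have q0 : q = q.-1.+1 by lia.
  have q0' := congr1 (fun a => a * (uphalf q * A'' * P)) q0.
  move: (uphalf q) (q.-1) qE' q0' => h r /=; lia.
by rewrite modnMDl.
Qed.

Lemma lin_bin j : j <= d -> lin (fun x => 'C(count id x, j)).
Proof.
move=> jd; have : forall A : {set 'I_n}, #|A| == j ->
    lin (fun x => \prod_(i <- enum A) tnth x i).
  move=> A /eqP Aj.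
  have := @lin_parity_prod (enum A) [::] false; rewrite /= -cardE Aj => /(_ jd).
  by apply: lin_ext => x; rewrite /parity big_nil mul1n.
move/lin_sum => /(_ (index_enum _)); apply: lin_ext => x.
by rewrite bin_count_monomials.
Qed.

Lemma lin_binpoly h : binpoly d h -> lin (fun x => h (count id x)).
Proof.
move=> [c cE]; have : forall j : 'I_d.+1, true -> lin (fun x => c j * 'C(count id x, j)).
  by move=> j _; apply/linZ/lin_bin; rewrite -ltnS.
by move/lin_sum => /(_ (index_enum _)); apply: lin_ext => x; rewrite cE.
Qed.

(* What the output gate can receive from at most s middle gates. *)
Definition top s F : Prop :=
  exists M : seq (gate n), [/\ all (feeds q) M, size M <= s
    & forall x, \sum_(g <- M) gate_val x (gate_vals x bot) g = F x %[mod 2]].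

Lemma top_ext s F F' : (forall x, F x = F' x %[mod 2]) -> top s F -> top s F'.
Proof. by move=> E [M [h1 h2 h3]]; exists M; split=> // x; rewrite h3. Qed.

Lemma top_leq s s' F : s <= s' -> top s F -> top s' F.
Proof. by move=> le [M [h1 h2 h3]]; exists M; split=> //; apply: leq_trans le. Qed.

Lemma top0 : top 0 (fun=> 0).
Proof. by exists [::]; split=> // x; rewrite big_nil. Qed.

Lemma topD s s' F F' : top s F -> top s' F' -> top (s + s') (fun x => F x + F' x).
Proof.
move=> [M [h1 h2 h3]] [M' [h1' h2' h3']]; exists (M ++ M'); split.
- by rewrite all_cat h1.
- by rewrite size_cat leq_add.
- by move=> x; rewrite big_cat; apply: modn_eqD.
Qed.

(** Modulo 2 a coefficient either keeps the gates or drops them, so no gate is added. *)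
Lemma topZ c s F : top s F -> top s (fun x => c * F x).
Proof.
move=> tF; case/boolP: (odd c) => [co|ce].
  by apply: top_ext tF => x; rewrite -modnMml (modn2 c) co mul1n.
apply: top_leq (leq0n s) (top_ext _ top0) => x.
by rewrite -modnMml (modn2 c) (negbTE ce).
Qed.

Lemma top_sum (I : Type) (r : seq I) (P : pred I) s (G : I -> n.-tuple bool -> nat) :
  (forall i, P i -> top s (G i)) ->
  top (count P r * s) (fun x => \sum_(i <- r | P i) G i x).
Proof.
move=> hG; elim: r => [|i r IH] /=.
  by apply: top_ext top0 => x; rewrite big_nil.
case Pi: (P i); last by apply: top_ext IH => x; rewrite big_cons Pi.
rewrite mulSn.
by apply: top_ext (topD (hG i Pi) IH) => x; rewrite big_cons Pi.
Qed.

Lemma top_lin L : lin L -> top 1 (fun x => q %| L x).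
Proof.
move=> [ws h1 h2]; exists [:: MkGate q ws]; split=> //.
  by rewrite /= /feeds eqxx h1.
by move=> x; rewrite big_seq1 /gate_val /= /dvdn h2.
Qed.

Lemma sum_dvdn_shift a : \sum_(0 <= i < q) (q %| a + i) = 1.
Proof.
have q0 : 0 < q by lia.
(* The only shift that counts is -a modulo [q]; the outer reduction covers the case where [q]
   divides [a]. *)
have lt : (q - a %% q) %% q < q by rewrite ltn_mod.
rewrite big_mkord (bigD1 (Ordinal lt)) //= big1 => [|i].
  rewrite addn0 /dvdn modnDmr -modnDml subnKC ?modnn //.
  by rewrite ltnW // ltn_mod.
apply: contraNeq; rewrite eqb0 negbK -val_eqE /= => qd.
apply/eqP; move: qd; rewrite /dvdn -modnDml.
have rq : a %% q < q by rewrite ltn_mod.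
have iq := ltn_ord i; set r := a %% q in rq *.
have [le|gt] := ltnP (r + i) q.
  rewrite modn_small // => /eqP r0; rewrite (_ : r = 0); last lia.
  rewrite subn0 modnn; lia.
have -> : r + i = (r + i - q) + q by lia.
rewrite modnDr modn_small => [/eqP ri|]; last lia.
rewrite modn_small; lia.
Qed.

(* Summing [q %| L + a * (1 - x_j)] over all residues a gives q * [q %| L] when
   x_j = 1 and exactly 1 when x_j = 0; as q is odd, modulo 2 this multiplies
   [q %| L] by x_j, up to the correction term 1 - x_j obtained from L = 1. *)
Lemma top_lin_prod S L : lin L ->
  top ((2 * q) ^ size S) (fun x => (q %| L x) * \prod_(i <- S) tnth x i).
Proof.
elim: S L => [|j S IH] L hL /=.
  by apply: top_ext (top_lin hL) => x; rewrite big_nil muln1.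
have shift L' a : lin L' -> lin (fun x => L' x + a * parity x [:: j] false).
  by move=> hL'; apply: linD => //; apply/linZ/lin_parity.
have T L' : lin L' -> top (q * (2 * q) ^ size S) (fun x => \sum_(0 <= a < q)
    (q %| L' x + a * parity x [:: j] false) * \prod_(i <- S) tnth x i).
  move=> hL'; have := top_sum (index_iota 0 q) (P := predT)
    (fun a _ => IH _ (shift L' a hL')).
  by rewrite count_predT size_iota subn0.
(* Two families of [q] shifts, one for [L] and one for the correction, give the factor [2 * q] per
   variable. *)
have := topD (T L hL) (T (fun=> 1) (lin_const 1)).
rewrite -mulnDl addnn -mul2n -expnS; apply: top_ext => x.
rewrite big_cons -!big_distrl /= /parity big_seq1 dvdn2 add0n.
set P := \prod_(i <- S) _; case: (tnth x j) => /=.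
  under eq_bigr do rewrite muln0 addn0.
  under [X in _ + X * _]eq_bigr do rewrite muln0 addn0 dvdn1 (gtn_eqF q_gt1).
  rewrite [X in _ + X * _]big1 // mul0n addn0 sum_nat_const_nat subn0 mul1n -mulnA.
  by rewrite -modnMml (modn2 q) q_odd mul1n.
under eq_bigr do rewrite muln1.
under [X in _ + X * _]eq_bigr do rewrite muln1.
by rewrite !sum_dvdn_shift mul0n muln0 addnn -mul2n modnMr mod0n.
Qed.

Lemma bin_leq_exp m j : 'C(m, j) <= m ^ j.
Proof.
have le : m ^_ j <= m ^ j.
  by elim: j => // j IH; rewrite ffactnSr expnSr leq_mul // leq_subr.
by apply: leq_trans le; rewrite -bin_ffact leq_pmulr // fact_gt0.
Qed.

Lemma top_bin L j : lin L -> j <= d ->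
  top (n.+1 ^ d * (2 * q) ^ d) (fun x => (q %| L x) * 'C(count id x, j)).
Proof.
move=> hL jd; apply: (@top_leq ('C(n, j) * (2 * q) ^ d)).
  rewrite leq_mul2r; apply/orP; right; apply: leq_trans (bin_leq_exp _ _) _.
  by apply: (@leq_trans (n.+1 ^ j)); [case: (j) => // i; rewrite leq_exp2r | rewrite leq_pexp2l].
have : forall A : {set 'I_n}, #|A| == j ->
    top ((2 * q) ^ d) (fun x => (q %| L x) * \prod_(i <- enum A) tnth x i).
  move=> A /eqP Aj; apply: top_leq (top_lin_prod (enum A) hL).
  by rewrite -cardE Aj leq_pexp2l //; lia.
move/(top_sum (index_enum _)).
have -> : count (fun A : {set 'I_n} => #|A| == j) (index_enum _) = 'C(n, j).
  by rewrite -[n in RHS]card_ord -card_draws cardsE cardE -size_filter /enum_mem.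
by apply: top_ext => x; rewrite bin_count_monomials big_distrr.
Qed.

Lemma top_binpoly g h : binpoly d g -> binpoly d h ->
  top (d.+1 * (n.+1 ^ d * (2 * q) ^ d))
    (fun x => (q %| h (count id x)) * g (count id x)).
Proof.
move=> [c cE] /lin_binpoly hL.
have : forall j : 'I_d.+1, true -> top (n.+1 ^ d * (2 * q) ^ d)
    (fun x => c j * ((q %| h (count id x)) * 'C(count id x, j))).
  by move=> j _; apply/topZ/(top_bin hL); rewrite -ltnS.
move/(top_sum (index_enum _)); rewrite count_predT -sum1_size big_const_ord iter_addn_0 mul1n.
apply: top_ext => x; rewrite cE big_distrr /=; congr (_ %% _).
by apply: eq_bigr => j _; rewrite mulnCA.
Qed.

(** The summands account for the parity layer, for the middle gates of each of the n + 1 weights,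
    and for the output gate. *)
Definition circuit_bound : nat :=
  n.+1 ^ d * 2 + n.+1 * (d.+1 * (n.+1 ^ d * (2 * q) ^ d)) + 1.

Lemma symmetric_circuit (f : n.-tuple bool -> bool) : symmetric_bf f ->
  (forall k, k <= n -> exists g h, [/\ binpoly d g, binpoly d h
     & forall N, N <= n -> (q %| h N) && odd (g N) = (N == k)]) ->
  exists C : circuit n, [/\ MOD_circuit (2 * q) C, circuit_depth C <= 3,
    MOD3_form 2 q 2 C, computes C f & size C <= circuit_bound].
Proof.
move=> fsym exact_weight.
have cn (x : n.-tuple bool) : count id x <= n by rewrite -[leqRHS](size_tuple x) count_size.
(* By symmetry, [phi k] is the value of [f] on all inputs of weight [k], and false if there are
   none. *)
pose phi k := [exists x : n.-tuple bool, (count id x == k) && f x].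
have phiE x : phi (count id x) = f x.
  apply/existsP/idP => [[y /andP[/eqP yx]]|fx]; first by rewrite (fsym _ _ yx).
  by exists x; rewrite eqxx.
have wt : forall k : 'I_n.+1, true -> top (d.+1 * (n.+1 ^ d * (2 * q) ^ d))
    (fun x => phi k * (count id x == k)).
  move=> k _; apply: topZ; have [|g [h [gb hb E]]] := exact_weight k.
    by rewrite -ltnS.
  apply: top_ext (top_binpoly gb hb) => x; rewrite -E // -modnMmr (modn2 (g _)).
  by case: (q %| _); case: (odd _).
have [mid [midP midS midE]] := top_sum (index_enum _) wt.
have {}midE x : \sum_(g <- mid) gate_val x (gate_vals x bot) g = f x %[mod 2].
  rewrite midE -phiE; congr (_ %% _).
  have lt : count id x < n.+1 by rewrite ltnS.
  rewrite (bigD1 (Ordinal lt)) //= eqxx muln1 big1 ?addn0 // => i ni.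
  by rewrite (_ : (_ == _) = false) ?muln0 //; apply: contraNF ni => /eqP E; apply/eqP/val_inj.
(* The constant 1 turns the test for an even sum into a test for an odd one. *)
pose out : gate n := MkGate 2 (Const true :: [seq Gate (size bot + i) | i <- iota 0 (size mid)]).
have outP : (gmod out == 2) &&
    all (reads_gates (size bot) (size bot + size mid)) (gwires out).
  rewrite /= all_map; apply/allP => i; rewrite mem_iota /= => im.
  by rewrite leq_addr ltn_add2l.
have botP := parity_layer_inputs n d.
exists (bot ++ mid ++ [:: out]); split.
- by apply: (three_layers_MOD botP midP outP (dvdn_mulr q (dvdnn 2))
    (dvdn_mull 2 (dvdnn q)) (dvdn_mulr q (dvdnn 2))).
- exact: (three_layers_depth botP midP outP).
- by exists bot, mid, out.
- move=> x; rewrite (three_layers_val outP) (three_layers_vals midP).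
  rewrite /gate_val /= big_cons big_map /=.
  set v := gate_vals x bot; have vs : size v = size bot := size_gate_vals x bot.
  have -> : \sum_(i <- iota 0 (size mid))
      nth false (v ++ [seq gate_val x v g | g <- mid]) (size bot + i) =
      \sum_(g <- mid) gate_val x v g.
    rewrite (big_nth (MkGate 0 [::])) /index_iota subn0 !big_seq.
    apply: eq_bigr => i; rewrite mem_iota => /andP[_ im].
    rewrite nth_cat vs ltnNge leq_addr /= addKn.
    by rewrite (nth_map (MkGate 0 [::])).
  by rewrite /dvdn -modnDmr midE modnDmr; case: (f x).
rewrite !size_cat /= size_parity_layer addnA leq_add2r leq_add2l.
by apply: leq_trans midS _; rewrite count_predT -sum1_size big_const_ord iter_addn_0 mul1n.
Qed.

End Simulation.

(** * Choice of parameters *)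

Lemma root_ceil n r : 0 < r -> exists t, [/\ 0 < t, t.-1 ^ r <= n & n < t ^ r].
Proof.
move=> r0; have ex : exists t, n < t ^ r.
  by exists n.+1; apply: (@leq_trans (n.+1 ^ 1)); rewrite ?leq_pexp2l ?expn1.
case: (ex_minnP ex) => t nt min; exists t; split=> //.
  by case: t nt {min} => //; rewrite exp0n.
case: t nt min => [|t] nt min; first by rewrite exp0n.
by rewrite leqNgt; apply/negP => /min; rewrite ltnn.
Qed.

Lemma prod_geq (ps : seq nat) (F : nat -> nat) t :
  (forall p, p \in ps -> t <= F p) -> t ^ size ps <= \prod_(p <- ps) F p.
Proof.
elim: ps => [|p ps IH] h; first by rewrite big_nil.
rewrite big_cons /= expnS leq_mul ?h ?mem_head //.
by apply: IH => p' p'ps; apply: h; rewrite inE p'ps orbT.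
Qed.

(** With Y = (n+1)^d, each of n + 1, d + 1 and (2q)^d is at most Y, so the middle layer has at most
    Y^4 gates; as Y >= 4, the total is at most Y^5. *)
Lemma circuit_bound_leq n d q : 0 < d -> 2 * q <= n.+1 -> 1 < q ->
  circuit_bound n d q <= n.+1 ^ (5 * d).
Proof.
move=> d0 qn q1; rewrite /circuit_bound.
set X := n.+1 in qn *; have X4 : 4 <= X by lia.
set Y := X ^ d; have XY : X <= Y by rewrite -{1}(expn1 X) leq_pexp2l.
have dY : d.+1 <= Y.
  apply: leq_trans (ltn_expl d (isT : 1 < 2)) _.
  by rewrite leq_exp2r //; lia.
have qY : (2 * q) ^ d <= Y by rewrite leq_exp2r.
have -> : X ^ (5 * d) = Y * (Y * (Y * (Y * Y))).
  by rewrite mulnC expnM -/Y !expnS expn0 muln1.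
have big : X * (d.+1 * (Y * (2 * q) ^ d)) <= Y * (Y * (Y * Y)).
  by rewrite leq_mul // leq_mul // leq_mul.
set Z := Y * (Y * (Y * Y)) in big *.
have : Y <= Z by rewrite /Z leq_pmulr // !muln_gt0; lia.
have : 4 * Z <= Y * Z by rewrite leq_mul2r; lia.
lia.
Qed.

Section Primes.
Variable ps : seq nat.
Hypotheses (pr : all prime (2 :: ps)) (un : uniq (2 :: ps)) (ps0 : 0 < size ps).
Let q := \prod_(p <- ps) p.

Lemma prod_odd_primes_odd : odd q.
Proof.
case/andP: pr un => _ prs /andP[n2 _].
rewrite /q big_seq; elim/big_rec: _ => // p a pps oa; rewrite oddM oa andbT.
have [p2|//] := even_prime (allP prs _ pps).
by rewrite -p2 pps in n2.
Qed.

Lemma prod_odd_primes_gt1 : 1 < q.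
Proof.
have : 2 ^ size ps <= q.
  by apply: (prod_geq (F := id)) => p pps; apply: prime_gt1; apply: (allP pr); rewrite inE pps orbT.
by apply: leq_trans; rewrite -{1}(expn1 2) leq_exp2l.
Qed.

Lemma leq_prod_primes p : p \in 2 :: ps -> p <= 2 * q.
Proof.
move=> pps; have q0 : 0 < 2 * q by have := prod_odd_primes_gt1; lia.
apply: dvdn_leq => //.
have -> : 2 * q = \prod_(p <- 2 :: ps) p by rewrite big_cons.
by rewrite (big_rem p) //= dvdn_mulr.
Qed.

(** The prime powers p^(e p) are pairwise coprime with product above [n], so their residues
    determine a weight up to [n]; each is at most p t <= 2 q t, which keeps the degrees within
    [d]. *)
Lemma exact_weight n t d : 0 < t -> n < t ^ (size ps).+1 ->
  2 * q * t <= d -> forall k, k <= n -> exists g h,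
    [/\ binpoly d g, binpoly d h
      & forall N, N <= n -> (q %| h N) && odd (g N) = (N == k)].
Proof.
move=> t0 nt dt k kn; pose e p := up_log p t.
have p1 p : p \in 2 :: ps -> 1 < p by move=> /(allP pr)/prime_gt1.
have tp p : p \in 2 :: ps -> t <= p ^ e p by move=> /p1 ?; apply: up_logP.
have pd p : p \in 2 :: ps -> p ^ e p <= d.+1.
  move=> pps; apply: leqW; apply: leq_trans dt; have p_gt1 := p1 p pps.
  (* For t = 1 the exponent is 0 and has no predecessor, so the bound through p^(e p - 1) < t needs
     t > 1. *)
  have [t1|t1] := leqP t 1.
    rewrite /e (_ : up_log p t = 0) ?expn0; last by apply/eqP; rewrite up_log_eq0 t1 orbT.
    have := prod_odd_primes_gt1; nia.
  have := up_log_gtn p_gt1 t1; have := leq_prod_primes pps.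
  rewrite -/(e p) => pq lt.
  have -> : p ^ e p = p * p ^ (e p).-1.
    by rewrite -expnS prednK // /e up_log_gt0 p_gt1.
  by rewrite leq_mul // ltnW.
case/andP: (pr) => pr2 prs; case/andP: (un) => _ uns.
have [|g gb gE] := residue_binpoly k pr2 (e := e 2) (d := d).
  by apply: pd; rewrite mem_head.
have [|h hb hE] := residues_binpoly (e := e) (d := d) k prs uns.
  by move=> p pps; apply: pd; rewrite inE pps orbT.
exists g, h; split=> // N Nn; rewrite hE.
have -> : odd (g N) = (N == k %[mod 2 ^ e 2]).
  by have := gE N; rewrite !modn2; case: (odd _); case: eqP.
have := chinese_remainder_seq e N k pr un; rewrite /= andbC => ->.
have nP : n < \prod_(p <- 2 :: ps) p ^ e p.
  by apply: leq_trans nt _; apply: (@prod_geq (2 :: ps)).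
by rewrite !modn_small // (leq_ltn_trans _ nP).
Qed.

Lemma symmetric_circuit_primes n : exists2 t, t.-1 ^ (size ps).+1 <= n &
  forall f : n.-tuple bool -> bool, symmetric_bf f ->
  exists C : circuit n, [/\ MOD_circuit (2 * q) C, circuit_depth C <= 3,
    MOD3_form 2 q 2 C, computes C f
    & 2 * q <= n -> size C <= n.+1 ^ (5 * (2 * q * t))].
Proof.
have [t [t0 tn nt]] := root_ceil n (ltn0Sn (size ps)).
exists t => // f fsym; have q1 := prod_odd_primes_gt1.
have d0 : 0 < 2 * q * t by rewrite !muln_gt0 t0; lia.
have [C [h1 h2 h3 h4 h5]] := symmetric_circuit d0 prod_odd_primes_odd q1 fsym
  (exact_weight t0 nt (leqnn _)).
exists C; split=> // qn; apply: leq_trans h5 _; apply: circuit_bound_leq => //.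
exact: leqW.
Qed.

End Primes.

(** * Size estimates over the reals and choice of the primes *)

Import Order.TTheory GRing.Theory Num.Theory.
Local Open Scope ring_scope.

(** From a ln x = ln (x^a) <= x^a. It absorbs the logarithm into the gap between 1/r and [eps]. *)
Lemma ln_le_powR (R : realType) (x a : R) : 1 <= x -> 0 < a -> ln x <= x `^ a / a.
Proof.
move=> x1 a0; rewrite ler_pdivlMr // mulrC -ln_powR.
by apply: le_trans (ltW (ln_sublinear _)) _; rewrite ?powR_gt0 ?(lt_le_trans ltr01).
Qed.

(** With a = eps - 1/r, one has t <= 2 n^(1/r) and ln (n+1) <= 2 ln n <= 2 n^a / a; the product of
    the two bounds is (4/a) n^eps. *)
Lemma exp_root_leq (R : realType) (eps : R) (r n t c : nat) :
  (0 < r)%N -> r%:R^-1 < eps -> (1 < n)%N -> (t.-1 ^ r <= n)%N ->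
  (n.+1 ^ (c * t))%:R <=
    expR ((4 * c)%:R / (eps - r%:R^-1) * n%:R `^ eps).
Proof.
move=> r0 reps n1 tn; set a := eps - _; have a0 : 0 < a by rewrite subr_gt0.
have n0 : 0 < n%:R :> R by rewrite ltr0n ltnW.
have n1R : 1 <= n%:R :> R by rewrite ler1n ltnW.
have rt1 : 1 <= n%:R `^ r%:R^-1 :> R.
  have : 1 `^ r%:R^-1 <= n%:R `^ r%:R^-1 :> R.
    by rewrite ge0_ler_powR ?nnegrE ?ler01 ?invr_ge0 ?ler0n.
  by rewrite powR1.
have tle : t%:R <= 2 * n%:R `^ r%:R^-1 :> R.
  have : t.-1%:R <= n%:R `^ r%:R^-1 :> R.
    have -> : t.-1%:R = (t.-1 ^ r)%:R `^ r%:R^-1 :> R.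
      by rewrite natrX -powR_mulrn ?ler0n // -powRrM mulfV ?powRr1 ?ler0n // pnatr_eq0 -lt0n.
    by rewrite ge0_ler_powR ?nnegrE ?invr_ge0 ?ler0n // ler_nat.
  have : t%:R <= t.-1%:R + 1 :> R by rewrite natr1 ler_nat; case: (t).
  lra.
have lnS : ln n.+1%:R <= 2 * (n%:R `^ a / a) :> R.
  apply: le_trans (_ : 2 * ln n%:R <= _); last by rewrite ler_pM2l // ln_le_powR.
  rewrite mulrC mulr_natr -lnXn // ler_ln ?posrE ?exprn_gt0 ?ltr0n ?(ltnW n1) //.
  by rewrite -natrX ler_nat; nia.
rewrite -[leLHS]lnK ?posrE ?ltr0n ?expn_gt0 // ler_expR natrX lnXn ?ltr0n //.
rewrite -(mulr_natl _ (c * t)) natrM -mulrA.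
have -> : n%:R `^ eps = n%:R `^ r%:R^-1 * n%:R `^ a :> R.
  rewrite -powRD; first by congr (_ `^ _); rewrite /a; lra.
  by rewrite (gt_eqF n0) implybT.
have : t%:R * ln n.+1%:R <= 2 * n%:R `^ r%:R^-1 * (2 * (n%:R `^ a / a)) :> R.
  by apply: ler_pM => //; rewrite ?ler0n ?ln_ge0 ?ler1n.
move/(ler_wpM2l (ler0n R c)) => /le_trans; apply.
by rewrite le_eqVlt; apply/orP; left; apply/eqP; ring.
Qed.

Lemma primes_for_exponent (R : realType) (eps : R) : 0 < eps ->
  exists ps : seq nat, [/\ all prime (2%N :: ps), uniq (2%N :: ps), (0 < size ps)%N,
    ((2 * \prod_(p <- ps) p)%N%:R <= modulus_bound eps) & (size ps).+1%:R^-1 < eps].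
Proof.
move=> e0; have [le|gt] := leP eps 2^-1; last first.
  (* For eps > 1/2 two primes suffice, and the modulus 6 is the floor of the bound. *)
  exists [:: 3%N]; split=> //; rewrite /modulus_bound ?(lt_geF gt) ?le_max ?big_seq1 ?lexx //.
have inv2 : 2 <= eps^-1 by rewrite -[2]invrK lef_pV2 ?posrE ?invr_gt0.
(* With 2 there are s + 1 primes, and 1/(s+1) < eps; since s <= 1/eps, s^(2s) stays below the bound.
   The case s = 2 uses the floor 30. *)
pose s := Num.truncn eps^-1.
have /andP[s1 s2] : s%:R <= eps^-1 < s.+1%:R by apply: truncn_itv; rewrite invr_ge0 ltW.
have seps : s.+1%:R^-1 < eps by rewrite -[eps]invrK ltf_pV2 ?posrE ?invr_gt0.
have : (2 <= s)%N by rewrite truncn_ge_nat // invr_ge0 ltW.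
rewrite leq_eqVlt => /orP[/eqP s2E|s3].
  exists [:: 3%N; 5%N]; split=> //; last by rewrite /= s2E.
  by rewrite /modulus_bound le le_max !big_cons big_nil lexx.
have [ps [h1 h2 h3 h4]] := odd_primes_small_product s3.
exists ps; rewrite h3; split=> //; first exact: ltn_trans s3.
apply: (@le_trans _ _ (s ^ (2 * s))%:R); first by rewrite ler_nat.
rewrite /modulus_bound le_max; apply/orP; right.
rewrite natrX -powR_mulrn //.
have es0 : 0 <= eps^-1 by rewrite invr_ge0 ltW.
apply: (@le_trans _ _ (eps^-1 `^ (2 * s)%:R)).
  by rewrite ge0_ler_powR ?nnegrE ?ler0n.
rewrite ler_powR //; first by rewrite (le_trans _ inv2) // ler1n.
by rewrite natrM ler_pM2l.
Qed.

Local Close Scope ring_scope.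
Unset Implicit Arguments.

Theorem theorem1p1 (R : realType) (eps : R) :
  (0 < eps)%R ->
  exists (m p1 : nat) (ps : seq nat),
    [/\ all prime (p1 :: ps), uniq (p1 :: ps),
        m = p1 * \prod_(p <- ps) p,
        (m%:R <= modulus_bound eps)%R
      & exists (K : R) (N : nat),
          forall (n : nat) (f : n.-tuple bool -> bool), symmetric_bf f ->
          exists C : circuit n,
            [/\ MOD_circuit m C, circuit_depth C <= 3,
                MOD3_form p1 (\prod_(p <- ps) p) p1 C,
                computes C f
              & N <= n -> ((size C)%:R <= expR (K * n%:R `^ eps))%R]].
Proof.
move=> e0; have [ps [pr un sz le re]] := primes_for_exponent e0.
set q := \prod_(p <- ps) p in le *; have q1 : 1 < q := prod_odd_primes_gt1 pr sz.
exists (2 * q), 2, ps; split=> //.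
(* The constant is that of [exp_root_leq] for c = 10 q; the threshold 2 q comes from
   [circuit_bound_leq]. *)
exists ((4 * (5 * (2 * q)))%:R / (eps - (size ps).+1%:R^-1))%R, (2 * q) => n f fsym.
have [t tn /(_ f fsym)[C [h1 h2 h3 h4 h5]]] := symmetric_circuit_primes pr un sz n.
exists C; split=> // qn; have n1 : 1 < n by lia.
apply: le_trans (exp_root_leq (5 * (2 * q)) (ltn0Sn _) re n1 tn).
by rewrite ler_nat -mulnA h5.
Qed.
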